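(* Let $K$ be a field, $Q$ a finite quiver, $I$ an admissible ideal of $KQ$ and $A=KQ/I$. Let $M(w)$ be a string module over $A$ with string $w$ and snake graph $\mathcal G=\mathcal G(w)$, and let $N=N(w_1)\oplus\cdots\oplus N(w_m)$ be a canonical submodule of $M(w)$ with canonical embedding $\varphi$, where the $w_i$ are the substrings of $w$ supporting the summands. Let $\mathcal H_i$ be the snake subgraph of $\mathcal G$ given by $w_i$ via $\varphi$, and set $$P_\varphi=\Big(\bigcup_{i=1}^m P_{max}(\mathcal H_i)\Big)\ \cup\ P_{min}\big|_{\mathcal G\setminus\bigcup_{i=1}^m\mathcal H_i}.$$ Then the set of edges $P_\varphi$ is a perfect matching of $\mathcal G$, and $N=M(P_\varphi)$.
   Context: **Strings and string modules.** For an arrow $a$ of $Q$, $s(a)$ is its start and $t(a)$ its end; its formal inverse $a^{-1}$ satisfies $s(a^{-1})=t(a)$, $t(a^{-1})=s(a)$. A string is a word $w=a_1\cdots a_n$ in which each $a_i$ is an arrow or the inverse of an arrow, $s(a_{i+1})=t(a_i)$, $a_{i+1}\neq a_i^{-1}$ for all $i$, and no subword of $w$ or of its inverse lies in $I$; trivial strings (single vertices, $n=0$) are allowed. Its vertices are $v_1,\dots,v_{n+1}$, so $w=v_1a_1v_2\cdots a_nv_{n+1}$. The string module $M(w)$ over $A$ has basis $e_1,\dots,e_{n+1}$, with $e_i$ placed at vertex $v_i$; if $a_i$ is an arrow it sends $e_i\mapsto e_{i+1}$; if $a_i$ is the inverse of an arrow $b$, then $b$ sends $e_{i+1}\mapsto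 e_i$; all other actions of arrows on basis vectors are zero. A canonical submodule $N$ of $M(w)$ is a submodule spanned by a subset $\{e_i: i\in S\}$ of the basis, with the embedding $\varphi$ induced by the identity on the non-zero components. Splitting $S$ into its maximal intervals of consecutive indices gives $N=N(w_1)\oplus\cdots\oplus N(w_m)$, where $w_i$ is the substring of $w$ on the $i$-th interval and $N(w_i)$ is the string module of $w_i$. The snake subgraph $\mathcal H_i$ of $\mathcal G(w)$ consists of the tiles with indices in the $i$-th interval. **Snake graphs.** A tile is a unit square in the plane with sides parallel to the axes, viewed as a graph with 4 vertices and 4 edges. A snake graph is obtained from tiles $T_1,\dots,T_{n+1}$ by gluing, for each $i$, $T_{i+1}$ to $T_i$ along the right or the top edge of $T_i$. Three consecutive tiles form a straight piece if both gluings are to the right or both on top, and a zigzag otherwise. The snake graph $\mathcal G(w)$ of $w=a_1\cdots a_n$ has tiles $T_1,\dots,T_{n+1}$, with $T_i$ corresponding to $v_i$; $T_2$ is to the right of $T_1$ if $a_1$ is an arrow (direct) and on top of $T_1$ if $a_1$ is an inverse arrow; and for $2\le i\le n$ the tiles $T_{i-1},T_i,T_{i+1}$ form a zigzag if $a_{i-1},a_i$ are both direct or both inverse, and a straight piece otherwise. **Perfect matchings.** A perfect matching of a graph is a set of edges such that every vertex is incident to exactly one of them. A boundary edge of a snake graph is an edge belonging to only one of its tiles. The minimal perfect matching $P_{min}$ of $\mathcal G(w)$ is the perfect matching consisting of boundary edges only, such that whenever $v_i$ is a sink of $w$ (all letters of $w$ adjacent to $v_i$ point towards $v_i$, endpoints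 of $w$ included) the tile $T_i$ has two boundary edges in $P_{min}$. (If there is only one tile, $P_{min}$ is a fixed choice of one of the two perfect matchings.) The maximal perfect matching $P_{max}$ consists of all boundary edges not in $P_{min}$. The matchings $P_{min}(\mathcal H_i)$ and $P_{max}(\mathcal H_i)$ are defined in the same way for the snake graph $\mathcal H_i$ with string $w_i$; if $\mathcal H_i$ is a single tile, $P_{max}(\mathcal H_i)$ is the pair of opposite edges of that tile not contained in the minimal perfect matching $P_{min}$ of $\mathcal G$. $P_{min}|_{\mathcal G\setminus\bigcup_i\mathcal H_i}$ is the set of edges of $P_{min}$ (the minimal perfect matching of $\mathcal G$) that are not edges of any $\mathcal H_i$. **The module $M(P)$.** For a perfect matching $P$ of $\mathcal G(w)$, the symmetric difference $P\ominus P_{min}=(P\cup P_{min})\setminus(P\cap P_{min})$ encloses a set of tiles of $\mathcal G(w)$. $M(P)$ is the canonical submodule of $M(w)$ spanned by the $e_i$ such that $T_i$ is enclosed. *)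

(* Defs.v *)
From HB Require Import structures.
From Stdlib Require Import Relations.
From mathcomp Require Import all_boot all_order all_algebra.
From mathcomp Require Import finmap.
From mathcomp.multinomials Require Import monalg.
From mathcomp Require Import boolp classical_sets.

Set Implicit Arguments.
Unset Strict Implicit.
Unset Printing Implicit Defensive.

Import GRing.Theory Num.Theory.

Local Open Scope classical_set_scope.
Local Open Scope ring_scope.

(** ** Quivers, path algebras, admissible ideals *)

Record quiver := Quiver {
  Q0 : finType;
  Q1 : finType;
  src : Q1 -> Q0;
  tgt : Q1 -> Q0 }.

(* A path is a start vertex together with a sequence of composable arrows,
   read from left to right: the target of an arrow is the source of the next. *)
Fixpoint composable (Q : quiver) (v : Q0 Q) (s : seq (Q1 Q)) : bool :=
  if s is a :: s' then (src a == v) && composable (tgt a) s' else true.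

Record qpath (Q : quiver) := QPath {
  qpath_val : Q0 Q * seq (Q1 Q);
  _ : composable qpath_val.1 qpath_val.2 }.

HB.instance Definition _ (Q : quiver) := [isSub for @qpath_val Q].
HB.instance Definition _ (Q : quiver) := [Choice of qpath Q by <:].

Definition pstart (Q : quiver) (p : qpath Q) : Q0 Q := (val p).1.
Definition parrows (Q : quiver) (p : qpath Q) : seq (Q1 Q) := (val p).2.
Definition pend (Q : quiver) (p : qpath Q) : Q0 Q :=
  last (pstart p) [seq tgt a | a <- parrows p].

Definition pcomp (Q : quiver) (p q : qpath Q) : option (qpath Q) :=
  if pend p == pstart q then insub (pstart p, parrows p ++ parrows q) else None.

(* The path algebra KQ is the free K-module on the paths; kqmul extends
   concatenation bilinearly (non-composable paths multiply to 0). *)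
Definition pathalg (K : fieldType) (Q : quiver) := {malg K[qpath Q]}.

Definition kqmul (K : fieldType) (Q : quiver) (x y : pathalg K Q) :
    pathalg K Q :=
  \sum_(p <- msupp x) \sum_(q <- msupp y)
    if pcomp p q is Some r then << x@_p * y@_q *g r >> else 0.

Definition two_sided_ideal (K : fieldType) (Q : quiver)
    (I : set (pathalg K Q)) : Prop :=
  [/\ I 0,
      forall x y, I x -> I y -> I (x + y),
      forall x y, I y -> I (kqmul x y) &
      forall x y, I x -> I (kqmul x y)].

Definition ideal_gen (K : fieldType) (Q : quiver) (X : set (pathalg K Q)) :
    set (pathalg K Q) :=
  [set x | forall J, two_sided_ideal J -> X `<=` J -> J x].

Definition arrow_ideal (K : fieldType) (Q : quiver) : set (pathalg K Q) :=
  ideal_gen [set x | exists p : qpath Q, size (parrows p) = 1%N /\ x = << p >>].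

Fixpoint arrow_ideal_exp (K : fieldType) (Q : quiver) (m : nat) :
    set (pathalg K Q) :=
  if m is m'.+1 then
    ideal_gen [set z | exists x y,
      [/\ arrow_ideal_exp m' x, arrow_ideal y & z = kqmul x y]]
  else setT.

Definition admissible (K : fieldType) (Q : quiver) (I : set (pathalg K Q)) :
    Prop :=
  [/\ two_sided_ideal I,
      I `<=` @arrow_ideal_exp K Q 2 &
      exists m : nat, (2 <= m)%N /\ @arrow_ideal_exp K Q m `<=` I].

(** ** Words and strings *)

(* (a, true) is the arrow a and (a, false) is its formal inverse. *)
Definition letter (Q : quiver) : Type := (Q1 Q * bool)%type.
Definition direct (Q : quiver) (a : letter Q) : bool := a.2.
Definition linv (Q : quiver) (a : letter Q) : letter Q := (a.1, ~~ a.2).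
Definition lsrc (Q : quiver) (a : letter Q) : Q0 Q :=
  if direct a then src a.1 else tgt a.1.
Definition ltgt (Q : quiver) (a : letter Q) : Q0 Q :=
  if direct a then tgt a.1 else src a.1.

(* The start vertex is recorded so that trivial words make sense.
   Indices start at 0: letter k joins vertex k to vertex k.+1. *)
Record word (Q : quiver) := Word {
  wstart : Q0 Q;
  letters : seq (letter Q) }.

Definition wlen (Q : quiver) (w : word Q) : nat := size (letters w).

Definition wvertex (Q : quiver) (w : word Q) (k : nat) : Q0 Q :=
  last (wstart w) [seq ltgt a | a <- take k (letters w)].

Definition winv (Q : quiver) (w : word Q) : word Q :=
  Word (wvertex w (wlen w)) (rev [seq linv a | a <- letters w]).

(* The subword of w from vertex l to vertex r. *)
Definition subword (Q : quiver) (w : word Q) (l r : nat) : word Q :=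
  Word (wvertex w l) (take (r - l) (drop l (letters w))).

Definition word_of_path (Q : quiver) (p : qpath Q) : word Q :=
  Word (pstart p) [seq (a, true) | a <- parrows p].

Definition is_walk (Q : quiver) (w : word Q) : Prop :=
  forall k a, onth (letters w) k = Some a -> lsrc a = wvertex w k.

Definition reduced (Q : quiver) (w : word Q) : Prop :=
  forall k a b, onth (letters w) k = Some a ->
    onth (letters w) k.+1 = Some b -> b <> linv a.

(* Only subwords that are paths are elements of KQ. *)
Definition avoids (K : fieldType) (Q : quiver) (I : set (pathalg K Q))
    (w : word Q) : Prop :=
  forall (l r : nat) (p : qpath Q), (l <= r <= wlen w)%N ->
    subword w l r = word_of_path p -> ~ I << p >>.

Definition is_string (K : fieldType) (Q : quiver) (I : set (pathalg K Q))
    (w : word Q) : Prop :=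
  [/\ is_walk w, reduced w, avoids I w & avoids I (winv w)].

(* All letters adjacent to vertex i point towards it. *)
Definition sink (Q : quiver) (w : word Q) (i : nat) : Prop :=
  forall k a, onth (letters w) k = Some a ->
    (k.+1 = i -> direct a) /\ (k = i -> ~~ direct a).

(** ** String modules *)

(* M(w) is the space of row vectors of length wlen w + 1, with e_i the i-th
   standard row vector, and KQ acting by right multiplication: since paths
   compose from left to right, modules are right modules. *)
Definition arrow_mx (K : fieldType) (Q : quiver) (w : word Q) (b : Q1 Q) :
    'M[K]_((wlen w).+1) :=
  \matrix_(i, j)
    (((j == i.+1 :> nat) && (onth (letters w) i == Some (b, true)))
  || ((i == j.+1 :> nat) && (onth (letters w) j == Some (b, false))))%:R.

Definition vertex_mx (K : fieldType) (Q : quiver) (w : word Q) (v : Q0 Q) :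
    'M[K]_((wlen w).+1) :=
  \matrix_(i, j) ((i == j) && (wvertex w i == v))%:R.

Definition path_mx (K : fieldType) (Q : quiver) (w : word Q) (p : qpath Q) :
    'M[K]_((wlen w).+1) :=
  foldl (fun B b => B *m arrow_mx K w b) (vertex_mx K w (pstart p)) (parrows p).

Definition act (K : fieldType) (Q : quiver) (w : word Q) (x : pathalg K Q) :
    'M[K]_((wlen w).+1) :=
  \sum_(p <- msupp x) x@_p *: path_mx K w p.

(* A module over A = KQ/I is a KQ-module annihilated by I.  When I is generated
   by paths this holds for every string w; for other ideals it can fail: if
   a b - c d is in I but a b is not, then a b is a string. *)
Definition quotient_module (K : fieldType) (Q : quiver)
    (I : set (pathalg K Q)) (w : word Q) : Prop :=
  forall x, I x -> act w x = 0.

(* Subspaces are row spaces of matrices.  As A-modules are KQ-modules, the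
   A-submodules are the subspaces stable under KQ. *)
Definition submodule (K : fieldType) (Q : quiver) (w : word Q)
    (U : 'M[K]_((wlen w).+1)) : Prop :=
  forall x : pathalg K Q, stablemx U (act w x).

Definition basis_span (K : fieldType) (Q : quiver) (w : word Q)
    (S : {set 'I_((wlen w).+1)}) : 'M[K]_((wlen w).+1) :=
  (\sum_(i in S) <<delta_mx 0 i : 'rV[K]_((wlen w).+1)>>)%MS.

(* [l, r] is a maximal interval of consecutive indices in S. *)
Definition maximal_interval (n : nat) (S : {set 'I_n}) (l r : 'I_n) : Prop :=
  [/\ (l <= r)%N,
      forall k : 'I_n, (l <= k <= r)%N -> k \in S,
      forall k : 'I_n, k.+1 = l -> k \notin S &
      forall k : 'I_n, k = r.+1 :> nat -> k \notin S].

(** ** Snake graphs in the plane *)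

(* A cell is a unit square of the integer grid, given by its lower left corner.
   The edge (true, (x, y)) joins (x, y) to (x + 1, y), and (false, (x, y))
   joins (x, y) to (x, y + 1).  As gluing only goes right or up, the plane
   picture makes no identifications other than those of the gluing, so a snake
   graph is given by the sequence of its tiles. *)
Definition cell : Type := (int * int)%type.
Definition edge : Type := (bool * (int * int))%type.

Definition hpair (c : cell) : set edge :=
  [set (true, c); (true, (c.1, c.2 + 1))].
Definition vpair (c : cell) : set edge :=
  [set (false, c); (false, (c.1 + 1, c.2))].
Definition tile_edges (c : cell) : set edge := hpair c `|` vpair c.

Definition endpoints (e : edge) : set (int * int) :=
  [set e.2; if e.1 then (e.2.1 + 1, e.2.2) else (e.2.1, e.2.2 + 1)].

Definition edges (G : seq cell) : set edge :=
  [set e | exists2 c, c \in G & tile_edges c e].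
Definition vertices (G : seq cell) : set (int * int) :=
  [set v | exists2 e, edges G e & endpoints e v].
Definition boundary (G : seq cell) : set edge :=
  [set e | exists! c, c \in G /\ tile_edges c e].

Definition perfect_matching (G : seq cell) (P : set edge) : Prop :=
  P `<=` edges G /\
  forall v, vertices G v -> exists! e, P e /\ endpoints e v.

(* glued_right w k: tile k.+1 is glued to the right of tile k (else on top). *)
Definition is_direct (Q : quiver) (w : word Q) (k : nat) : bool :=
  if onth (letters w) k is Some a then direct a else true.

Fixpoint glued_right (Q : quiver) (w : word Q) (k : nat) : bool :=
  if k is k'.+1 then
    if is_direct w k' == is_direct w k then ~~ glued_right w k'
    else glued_right w k'
  else is_direct w 0.

Fixpoint tile (Q : quiver) (w : word Q) (k : nat) : cell :=
  if k is k'.+1 then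
    let c := tile w k' in
    if glued_right w k' then (c.1 + 1, c.2) else (c.1, c.2 + 1)
  else (0, 0).

Definition snake (Q : quiver) (w : word Q) : seq cell :=
  [seq tile w k | k <- iota 0 (wlen w).+1].

(* The subgraph of snake w with tiles l, ..., r. *)
Definition subsnake (Q : quiver) (w : word Q) (l r : nat) : seq cell :=
  [seq tile w k | k <- iota l (r - l).+1].

(** ** Minimal and maximal matchings *)

(* G is a snake graph whose tiles correspond to the vertices of w. *)
Definition is_pmin (Q : quiver) (w : word Q) (G : seq cell) (P : set edge) :
    Prop :=
  [/\ perfect_matching G P,
      P `<=` boundary G &
      forall i, (i <= wlen w)%N -> sink w i ->
        exists e f, e <> f /\
          P `&` boundary G `&` tile_edges (nth (0, 0) G i) = [set e; f]].

(* On a single tile, the boolean h fixes which of the two perfect matchings is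
   the minimal one.  On larger snake graphs xget picks the matching satisfying
   is_pmin (its default value set0 is not a perfect matching). *)
Definition pmin (h : bool) (Q : quiver) (w : word Q) (G : seq cell) :
    set edge :=
  if G is [:: c] then (if h then hpair c else vpair c)
  else xget set0 [set P | is_pmin w G P].

(* P_max of the subsnake with tiles l, ..., r. *)
Definition pmax (h : bool) (Q : quiver) (w : word Q) (l r : nat) : set edge :=
  if l == r then
    if `[< hpair (tile w l) `<=` pmin h w (snake w) >]
    then vpair (tile w l) else hpair (tile w l)
  else boundary (subsnake w l r) `\`
       pmin h (subword w l r) (subsnake w l r).

Definition pphi (h : bool) (Q : quiver) (w : word Q)
    (S : {set 'I_((wlen w).+1)}) : set edge :=
  [set e | exists l r, maximal_interval S l r /\ pmax h w l r e]
  `|` (pmin h w (snake w) `\`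
       [set e | exists l r, maximal_interval S l r /\
                            edges (subsnake w l r) e]).

(** ** The module of a perfect matching *)

(* Neighbouring cells of the plane separated by no edge of C. *)
Definition cell_step (C : set edge) (c c' : cell) : Prop :=
  exists e, [/\ tile_edges c e, tile_edges c' e & ~ C e].

(* c lies in a bounded component of the plane cut along C. *)
Definition enclosed (C : set edge) (c : cell) : Prop :=
  exists B : int, forall c', clos_refl_trans cell (cell_step C) c c' ->
    `|c'.1| <= B /\ `|c'.2| <= B.

Definition symdiff (A B : set edge) : set edge := (A `|` B) `\` (A `&` B).

Definition matching_module (K : fieldType) (h : bool) (Q : quiver)
    (w : word Q) (P : set edge) : 'M[K]_((wlen w).+1) :=
  basis_span K
    [set i : 'I_((wlen w).+1) |
      `[< enclosed (symdiff P (pmin h w (snake w))) (tile w i) >]]%SET.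

(* Main.v *)
(** Tile k of the snake graph lies on the antidiagonal x + y = k, and tile k.+1
    is glued to its right iff the k-th letter is direct and k is even or the
    letter is inverse and k is odd.  At a sink k the two parallel boundary edges are
    therefore horizontal iff k is odd, and since the two perfect matchings by boundary edges
    alternate along the boundary cycle, the minimal matching meets every tile k,
    sink or not, only in edges of this direction.  For a subset S of the tiles
    let matching S consist of the edges which, in every tile containing them, are
    of minimal direction if the tile is not in S and of the other direction if it
    is in S.  A check at each of the vertices shows that this is a perfect
    matching whenever S is closed under arrows, which is what being a submodule
    means.  Both P_min, P_max (also those of the subsnakes) and P_phi are of this
    form.  The symmetric difference of P_phi and P_min is then the set of edges
    lying in exactly one tile of S: one cannot leave the tiles of S without
    crossing it, while from any other tile a ray upwards or to the right meets no
    further tile and escapes to infinity. *)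

Require Import Defs.
From Stdlib Require Import Relations.
From mathcomp Require Import all_boot all_order all_algebra.
From mathcomp Require Import boolp classical_sets finmap.
From mathcomp Require Import monalg zify.

Set Implicit Arguments.
Unset Strict Implicit.
Unset Printing Implicit Defensive.

(** * Points, edges and cells of the integer grid in coordinates *)

Section Plane.
Local Open Scope ring_scope.
Local Open Scope classical_set_scope.
Import GRing.Theory.
Implicit Types (c : cell) (e : edge).

Lemma tile_edgesE c e : tile_edges c e <->
  if e.1 then e.2.1 = c.1 /\ (e.2.2 = c.2 \/ e.2.2 = c.2 + 1)
  else e.2.2 = c.2 /\ (e.2.1 = c.1 \/ e.2.1 = c.1 + 1).
Proof.
case: c e => [x y] [[] [u v]]; rewrite /tile_edges /hpair /vpair /setU /set1 /=.
  split; first by case=> [[[-> ->]|[-> ->]]|[]//]; split=> //; [left|right].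
  by case=> -> [] ->; left; [left|right].
split; first by case=> [[]//|[[-> ->]|[-> ->]]]; split=> //; [left|right].
by case=> -> [] ->; right; [left|right].
Qed.

Lemma endpointsE e v : endpoints e v <->
  if e.1 then v.2 = e.2.2 /\ (v.1 = e.2.1 \/ v.1 = e.2.1 + 1)
  else v.1 = e.2.1 /\ (v.2 = e.2.2 \/ v.2 = e.2.2 + 1).
Proof.
case: v e => [x y] [[] [u v]]; rewrite /endpoints /=.
  by split; [case=> -[-> ->]; split=> //; [left|right]|case=> -> [] ->; [left|right]].
by split; [case=> -[-> ->]; split=> //; [left|right]|case=> -> [] ->; [left|right]].
Qed.

Lemma pair_eq (T U : Type) (p q : T * U) : p = q <-> p.1 = q.1 /\ p.2 = q.2.
Proof. by case: p q => [a b] [c d] /=; split=> [[-> ->]|[-> ->]]. Qed.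

End Plane.

(** Incidence of points, edges and cells is linear arithmetic in their coordinates. *)
Ltac plane := rewrite ?tile_edgesE ?endpointsE ?pair_eq /=; lia.

(** * Adjacent cells and enclosure by a boundary *)

Section PlaneGraphs.
Local Open Scope ring_scope.
Local Open Scope classical_set_scope.
Import GRing.Theory.
Implicit Types (c d : cell) (e : edge) (G : seq cell).

Lemma cell_at_vertex c e x y : tile_edges c e -> endpoints e (x, y) ->
  [\/ c = (x, y), c = (x - 1, y), c = (x, y - 1) | c = (x - 1, y - 1)].
Proof.
case: c e => [x' y'] [[] [u v]]; rewrite tile_edgesE endpointsE /=.
  case=> -> yE [vE xE]; have [|] : x' = x \/ x' = x - 1 by lia.
    by move=> ->; case: yE => yE; [apply: Or41|apply: Or43]; plane.
  by move=> ->; case: yE => yE; [apply: Or42|apply: Or44]; plane.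
case=> -> xE [uE yE]; have [|] : y' = y \/ y' = y - 1 by lia.
  by move=> ->; case: xE => xE; [apply: Or41|apply: Or42]; plane.
by move=> ->; case: xE => xE; [apply: Or43|apply: Or44]; plane.
Qed.

Lemma parallel_edges c (b : bool) e :
  tile_edges c e /\ e.1 = b <->
  e = (b, c) \/ e = (b, if b then (c.1, c.2 + 1) else (c.1 + 1, c.2)).
Proof. case: e b => [[] [u v]] []; plane. Qed.

Lemma two_cells c c' c'' e : tile_edges c e -> tile_edges c' e ->
  tile_edges c'' e -> c <> c' -> c'' = c \/ c'' = c'.
Proof. case: e => [[] [u v]]; plane. Qed.

(** A step out of [G] would cross an edge with exactly one of its two cells in [G], which is a
    boundary edge. So only the finitely many cells of [G] are reachable. *)
Lemma enclosed_mem G c : c \in G -> enclosed (boundary G) c.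
Proof.
move=> cG.
have stay c' : clos_refl_trans _ (cell_step (boundary G)) c c' -> c' \in G.
  move/clos_rt_rtn1_iff; elim=> // d d' [e [ed ed' nb]] _ dG.
  apply: contrapT => d'G; apply: nb; exists d; split=> // c2 [c2G ec2].
  have dd' : d <> d' by move=> dd'; rewrite -dd' dG in d'G.
  by case: (two_cells ed ed' ec2 dd') c2G d'G => ->.
have [B HB] : exists B : int, 0 <= B /\ forall d, d \in G -> `|d.1| <= B /\ `|d.2| <= B.
  elim: G {cG stay} => [|d G [B [B0 HB]]]; first by exists 0.
  exists (B + `|d.1| + `|d.2|); split=> [|d']; first lia.
  rewrite inE => /predU1P[->|/HB]; lia.
by exists B => d /stay; apply: HB.2.
Qed.

(** The edge between consecutive cells of the ray lies on no other cell, so it is not a boundary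
    edge of [G] and the walk along the ray never stops. *)
Lemma not_enclosed_ray G c (r : bool) :
  (forall m : nat, (if r then (c.1 + m%:Z, c.2) else (c.1, c.2 + m%:Z)) \notin G) ->
  ~ enclosed (boundary G) c.
Proof.
set ray := fun m : nat => if r then (c.1 + m%:Z, c.2) else (c.1, c.2 + m%:Z).
move=> out [B HB].
have reach m : clos_refl_trans _ (cell_step (boundary G)) c (ray m).
  elim: m => [|m IH].
    suff -> : ray 0 = c by apply: rt_refl.
    by rewrite /ray !addr0; case: (c) (r) => ? ? [].
  apply: rt_trans IH _; apply: rt_step.
  have [e em em'] : exists2 e, tile_edges (ray m) e & tile_edges (ray m.+1) e.
    exists (~~ r, ray m.+1); rewrite /ray; case: (r); plane.
  exists e; split=> // -[d [[dG ed] _]].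
  have ne : ray m <> ray m.+1 by rewrite /ray; case: (r); plane.
  by case: (two_cells em em' ed ne) dG => ->; apply/negP; apply: out.
(* So many steps push the moving coordinate beyond [B], whichever it is. *)
have := HB _ (reach (`|B - c.1|%N + `|B - c.2|%N).+1); rewrite /ray.
by case: (r) => /=; lia.
Qed.

End PlaneGraphs.

(** * Positions of the tiles of a snake graph *)

Section Snake.
Local Open Scope ring_scope.
Local Open Scope classical_set_scope.
Import GRing.Theory.
Variables (Q : quiver) (w : word Q).
Implicit Types (c : cell) (e : edge) (G : seq cell) (P : set edge).
Implicit Types (k l r : nat) (sg : pred nat).

Lemma tile_sum k : (tile w k).1 + (tile w k).2 = k%:Z.
Proof. by elim: k => //= k IH; case: ifP => _ /=; lia. Qed.

(** A zigzag turns the gluing direction and a straight piece keeps it, so relative to the letters it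
    flips at every step. *)
Lemma glued_rightE k : glued_right w k = is_direct w k (+) odd k.
Proof.
elim: k => [|k IH] /=; first by rewrite addbF.
by rewrite IH; case: (is_direct w k) (is_direct w k.+1) (odd k) => [] [] [].
Qed.

Lemma mem_subsnake l r c : (l <= r)%N ->
  (c \in subsnake w l r) <-> exists2 k, (l <= k <= r)%N & c = tile w k.
Proof.
move=> lr; split=> [/mapP[k]|[k kb ->]].
  by rewrite mem_iota => kb ->; exists k => //; lia.
by apply: map_f; rewrite mem_iota; lia.
Qed.

Lemma snakeE : snake w = subsnake w 0 (wlen w).
Proof. by rewrite /snake /subsnake subn0. Qed.

(** The index of a tile, read off its position; it lets conditions on indices be stated for
    cells. *)
Definition level c : nat := `|c.1 + c.2|.

Lemma level_tile k : level (tile w k) = k.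
Proof. by rewrite /level tile_sum. Qed.

Lemma tile_inj : injective (tile w).
Proof. by move=> k k' E; rewrite -(level_tile k) E level_tile. Qed.

Lemma tile_mono k k' : (k <= k')%N ->
  (tile w k).1 <= (tile w k').1 /\ (tile w k).2 <= (tile w k').2.
Proof.
elim: k' => [|k' IH]; first by rewrite leqn0 => /eqP ->.
by rewrite leq_eqVlt => /predU1P[->//|/IH] /=; case: ifP => _ /=; lia.
Qed.

(** The ray is perpendicular to the gluing after tile [k]. Later tiles lie strictly further in the
    direction of that gluing, and the tiles up to [k] lie on lower antidiagonals than the ray. *)
Lemma tile_off_ray k j (m : nat) :
  (if glued_right w k then ((tile w k).1, (tile w k).2 + m.+1%:Z)
   else ((tile w k).1 + m.+1%:Z, (tile w k).2)) <> tile w j.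
Proof.
move=> E; have kj : (k < j)%N.
  by have := tile_sum j; have := tile_sum k; rewrite -E; case: ifP => _ /=; lia.
by have := tile_mono kj; rewrite -E /=; case: ifP => _ /=; lia.
Qed.

(** The coordinate sums of two distinct cells sharing an edge differ by at most one, and the edge is
    perpendicular to the gluing. *)
Lemma shared_edge k k' e : (k < k')%N ->
  tile_edges (tile w k) e -> tile_edges (tile w k') e ->
  k' = k.+1 /\ e.1 = ~~ glued_right w k.
Proof.
move=> kk'; have := tile_sum k; have := tile_sum k'.
rewrite !tile_edgesE => s' s He He'.
have E : k' = k.+1 by case: e He He' => [[] [u v]] /=; lia.
subst; split=> //; move: He'; rewrite /=.
by case: e He {s'} => [[] [u v]] /=; case: ifP => _ /=; lia.
Qed.

Lemma shared_edge_ex k : exists2 e, tile_edges (tile w k) e & tile_edges (tile w k.+1) e.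
Proof.
exists (~~ glued_right w k, tile w k.+1) => /=; case: (glued_right w k); plane.
Qed.

(** * Matchings prescribed by a set of tiles *)

(* Whether the minimal matching meets tile k in horizontal edges only.  On a
   one-tile snake graph this is the convention h. *)
Definition min_horizontal (h : bool) k : bool := odd k (+) ((wlen w == 0%N) && h).

(* sg = pred0 gives the minimal matching and sg = predT the maximal one.  For
   arrow-closed sg, an edge shared by two tiles belongs to it iff the tile at the
   target of the arrow is in sg and the other one is not. *)
Definition matching h G sg : set edge :=
  [set e | edges G e /\ forall c, c \in G -> tile_edges c e ->
     sg (level c) = (e.1 != min_horizontal h (level c))].

Definition arrow_closed sg := forall k, (k < wlen w)%N ->
  if is_direct w k then sg k -> sg k.+1 else sg k.+1 -> sg k.

(** Boolean form of the condition at one cell, so that the check at a vertex becomes a finite case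
    analysis. *)
Definition fits h G sg c e : bool :=
  (c \in G) ==> (sg (level c) == (e.1 != min_horizontal h (level c))).

(** An edge lies on only two cells of the plane: [c1] above it or to its right, [c2] below it or to
    its left. *)
Lemma matchingE h G sg e (c1 := e.2)
  (c2 := if e.1 then (e.2.1, e.2.2 - 1) else (e.2.1 - 1, e.2.2)) :
  matching h G sg e <->
  [&& (c1 \in G) || (c2 \in G), fits h G sg c1 e & fits h G sg c2 e].
Proof.
have cells c : tile_edges c e <-> c = c1 \/ c = c2.
  by rewrite /c1 /c2; clear; case: e => [[] [u v]]; plane.
split=> [[[c cG /cells ce]] H|/and3P[some f1 f2]].
  apply/and3P; split.
  - by case: ce cG => -> ->; rewrite ?orbT.
  - by apply/implyP => cG'; apply/eqP/H => //; apply/cells; left.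
  - by apply/implyP => cG'; apply/eqP/H => //; apply/cells; right.
split; first by case/orP: some => cG; [exists c1|exists c2] => //; apply/cells; [left|right].
move=> c cG /cells[] E; rewrite E in cG *; apply/eqP; first exact: (implyP f1).
exact: (implyP f2).
Qed.

Lemma odd_absz_pred (z : int) : odd `|z - 1|%N = ~~ odd `|z|%N.
Proof. lia. Qed.

(* ne, nw, se, sw: which of the four cells around a vertex are tiles; sne, ...:
   which are in the submodule; p: whether the minimal edges of the cell ne are
   horizontal.  The four conditions [if p then ...] express closure under
   arrows. *)
Lemma star_unique (p ne nw se sw sne snw sse ssw : bool)
  (eE := [&& ne || se, ne ==> (sne == (true != p)) & se ==> (sse == (true != ~~ p))])
  (eN := [&& ne || nw, ne ==> (sne == (false != p)) & nw ==> (snw == (false != ~~ p))])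
  (eW := [&& nw || sw, nw ==> (snw == (true != ~~ p)) & sw ==> (ssw == (true != p))])
  (eS := [&& se || sw, se ==> (sse == (false != ~~ p)) & sw ==> (ssw == (false != p))]) :
  [|| ne, nw, se | sw] -> ~~ (nw && se) -> (ne && sw ==> nw || se) ->
  (nw && ne ==> if p then snw ==> sne else sne ==> snw) ->
  (sw && se ==> if p then sse ==> ssw else ssw ==> sse) ->
  (se && ne ==> if p then sne ==> sse else sse ==> sne) ->
  (sw && nw ==> if p then ssw ==> snw else snw ==> ssw) ->
  count id [:: eE; eN; eW; eS] == 1%N.
Proof.
rewrite {}/eE {}/eN {}/eW {}/eS.
by case: ne; case: nw; case: se; case: sw => //; case: p;
   case: sne; case: snw; case: sse; case: ssw.
Qed.

(** Geometric form of [arrow_closed]: the arrow between two glued tiles starts at [c] exactly when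
    their common edge has minimal direction in [c]. *)
Lemma closed_step h l r sg (b : bool) c c' : (l <= r <= wlen w)%N -> arrow_closed sg ->
  c' = (if b then (c.1 + 1, c.2) else (c.1, c.2 + 1)) ->
  (c \in subsnake w l r) && (c' \in subsnake w l r) ==>
  if min_horizontal h (level c) (+) b then sg (level c) ==> sg (level c')
  else sg (level c') ==> sg (level c).
Proof.
move=> /andP[lr rn] cl c'E; apply/implyP => /andP[].
move=> /(mem_subsnake _ lr)[k kb cE] /(mem_subsnake _ lr)[k' kb' c'E'].
have k'E : k' = k.+1.
  by have := tile_sum k; have := tile_sum k'; rewrite -cE -c'E' c'E; case: (b) => /=; lia.
rewrite {k'}k'E in kb' c'E'; rewrite cE c'E' !level_tile; rewrite cE c'E' in c'E.
have kn : (k < wlen w)%N by lia.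
have -> : b = glued_right w k.
  by move: c'E => /=; case: (b); case: (glued_right w k) => //; plane.
have := cl k kn; rewrite glued_rightE /min_horizontal.
have -> : (wlen w == 0)%N = false by lia.
by case: (is_direct w k) (odd k) => [] [] /= H; apply/implyP.
Qed.

(** Going round a vertex, the parity of the levels of the four cells alternates, hence so does the
    minimal direction; [star_unique] then finds one matching edge among the four edges at the
    vertex. *)
Lemma matching_perfect h l r sg : (l <= r <= wlen w)%N -> arrow_closed sg ->
  perfect_matching (subsnake w l r) (matching h (subsnake w l r) sg).
Proof.
move=> lrn cl; set G := subsnake w l r; split; first by move=> e [].
case=> x y [e [c cG ce] ev].
have /andP[lr rn] := lrn.
have star := @star_unique (min_horizontal h (level (x, y)))
  ((x, y) \in G) ((x - 1, y) \in G) ((x, y - 1) \in G) ((x - 1, y - 1) \in G)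
  (sg (level (x, y))) (sg (level (x - 1, y))) (sg (level (x, y - 1)))
  (sg (level (x - 1, y - 1))).
have lW : min_horizontal h (level (x - 1, y)) = ~~ min_horizontal h (level (x, y)).
  by rewrite /min_horizontal /level /= addrAC odd_absz_pred addNb.
have lS : min_horizontal h (level (x, y - 1)) = ~~ min_horizontal h (level (x, y)).
  by rewrite /min_horizontal /level /= addrA odd_absz_pred addNb.
have lSW : min_horizontal h (level (x - 1, y - 1)) = min_horizontal h (level (x, y)).
  rewrite /min_horizontal /level /=; have -> : x - 1 + (y - 1) = x + y - 1 - 1 by lia.
  by rewrite !odd_absz_pred negbK.
have {star} : count id [:: `[< matching h G sg (true, (x, y)) >];
    `[< matching h G sg (false, (x, y)) >]; `[< matching h G sg (true, (x - 1, y)) >];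
    `[< matching h G sg (false, (x, y - 1)) >]] == 1%N.
  rewrite !(asbool_equiv_eq (matchingE _ _ _ _)) !asboolb /= /fits lW lS lSW.
  apply: star.
  - by case: (cell_at_vertex ce ev) => E; rewrite -E cG ?orbT.
  - apply/negP => /andP[/(mem_subsnake _ lr)[k _ E] /(mem_subsnake _ lr)[k' _ E']].
    have kk' : k = k' by have := tile_sum k; have := tile_sum k'; rewrite -E -E' /=; lia.
    by move: E'; rewrite -kk' -E; plane.
  (* The indices of two diagonally opposite tiles here differ by two, and the tile between them is
     one of the other two cells. *)
  - apply/implyP => /andP[/(mem_subsnake _ lr)[k kb E] /(mem_subsnake _ lr)[k' kb' E']].
    have kk' : k = k'.+2 by have := tile_sum k; have := tile_sum k'; rewrite -E -E' /=; lia.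
    have : tile w k'.+1 \in G by apply/(mem_subsnake _ lr); exists k'.+1 => //; lia.
    rewrite /= -E' /=; case: ifP => _ /=; rewrite subrK => ->; rewrite ?orbT //.
  - by have := closed_step h lrn cl (b := true) (c := (x - 1, y)) (c' := (x, y));
       rewrite /= lW subrK addbT negbK; apply.
  - by have := closed_step h lrn cl (b := true) (c := (x - 1, y - 1)) (c' := (x, y - 1));
       rewrite /= lSW subrK addbT if_neg; apply.
  - by have := closed_step h lrn cl (b := false) (c := (x, y - 1)) (c' := (x, y));
       rewrite /= lS subrK addbF if_neg; apply.
  - by have := closed_step h lrn cl (b := false) (c := (x - 1, y - 1)) (c' := (x - 1, y));
       rewrite /= lSW subrK addbF; apply.
move=> one.
have some e' : endpoints e' (x, y) -> [\/ e' = (true, (x, y)), e' = (true, (x - 1, y)),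
      e' = (false, (x, y)) | e' = (false, (x, y - 1))].
  by case: e' => [[] [u v]]; rewrite endpointsE /= => -[-> []->]; rewrite ?addrK;
    [apply: Or41|apply: Or42|apply: Or43|apply: Or44].
have uniq e' e'' : matching h G sg e' -> matching h G sg e'' ->
    endpoints e' (x, y) -> endpoints e'' (x, y) -> e' = e''.
  move=> /asboolT m' /asboolT m'' /some e'E /some e''E; move: one m' m''.
  by case: e'E => ->; case: e''E => -> // + m1 m2; rewrite m1 m2; do 2 case: asboolP.
have [e' [me' ee']] : exists e', matching h G sg e' /\ endpoints e' (x, y).
  move: one; case: (asboolP (matching h G sg (true, (x, y)))) => [?|_].
    by exists (true, (x, y)); split=> //; plane.
  case: (asboolP (matching h G sg (false, (x, y)))) => [?|_].
    by exists (false, (x, y)); split=> //; plane.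
  case: (asboolP (matching h G sg (true, (x - 1, y)))) => [?|_].
    by exists (true, (x - 1, y)); split=> //; plane.
  case: (asboolP (matching h G sg (false, (x, y - 1)))) => [?|//].
  by exists (false, (x, y - 1)); split=> //; plane.
by exists e'; split=> // e'' [me'' ee'']; apply: uniq.
Qed.

(** Distinct tiles sharing an edge have consecutive indices, so their minimal directions differ. *)
Lemma minimal_tile_unique h k k' e : tile_edges (tile w k) e -> tile_edges (tile w k') e ->
  (e.1 == min_horizontal h k) = (e.1 == min_horizontal h k') -> k = k'.
Proof.
move=> ek ek' E; case: (ltngtP k k') => // kk'; move: E.
  have [-> _] := shared_edge kk' ek ek'.
  by rewrite /min_horizontal /=; case: (e.1) (odd k) (_ && _) => [] [] [].
have [-> _] := shared_edge kk' ek' ek.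
by rewrite /min_horizontal /=; case: (e.1) (odd k') (_ && _) => [] [] [].
Qed.

Lemma minimal_opposite h k k' e : tile_edges (tile w k) e ->
  tile_edges (tile w k') e -> k <> k' ->
  (e.1 != min_horizontal h k') = ~~ (e.1 != min_horizontal h k).
Proof.
move=> ke ke' kk'; apply: contrapT => E; apply: kk'.
by apply: (minimal_tile_unique (h := h) ke ke'); move: E; do 2 case: (_ == _).
Qed.

(** The parities in the gluing and in the minimal direction cancel: a shared edge has minimal
    direction exactly in the tile at the source of its arrow. *)
Lemma shared_edge_minimal h k e : (k < wlen w)%N ->
  tile_edges (tile w k) e -> tile_edges (tile w k.+1) e ->
  (e.1 == min_horizontal h k) = is_direct w k.
Proof.
move=> kn ek ek'; have [//|_ ->] := shared_edge _ ek ek'.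
rewrite glued_rightE /min_horizontal; have -> : (wlen w == 0)%N = false by lia.
by case: (is_direct w k) (odd k) => [] [].
Qed.

(** * Boundary of a subsnake and uniqueness of its minimal matching *)

Section Range.
Variables (h : bool) (l r : nat).
Hypothesis lrn : (l <= r <= wlen w)%N.
Let G := subsnake w l r.
Let M := matching h G pred0.

Let lr : (l <= r)%N. Proof. by case/andP: lrn. Qed.

Lemma mem_tile k : (l <= k <= r)%N -> tile w k \in G.
Proof. by move=> kb; apply/mem_subsnake => //; exists k. Qed.

Lemma mem_edges e : edges G e <-> exists2 k, (l <= k <= r)%N & tile_edges (tile w k) e.
Proof.
split=> [[c /(mem_subsnake _ lr)[k kb ->] ce]|[k kb ke]]; first by exists k.
by exists (tile w k) => //; apply: mem_tile.
Qed.

Lemma matching_subsnakeE sg e : matching h G sg e <->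
  edges G e /\ forall k, (l <= k <= r)%N -> tile_edges (tile w k) e ->
     sg k = (e.1 != min_horizontal h k).
Proof.
split=> -[eG H]; split=> //; [move=> k kb ke|move=> c /(mem_subsnake _ lr)[k kb ->] ce].
  by rewrite -[k in sg k](level_tile k) H ?level_tile //; apply: mem_tile.
by rewrite level_tile; apply: H.
Qed.

Lemma boundaryE e : boundary G e <->
  exists2 k, (l <= k <= r)%N /\ tile_edges (tile w k) e &
    forall k', (l <= k' <= r)%N -> tile_edges (tile w k') e -> k' = k.
Proof.
split=> [[c [[/(mem_subsnake _ lr)[k kb ->] ke] U]]|[k [kb ke] U]].
  exists k => // k' kb' ke'; apply: tile_inj; symmetry; apply: U; split=> //.
  exact: mem_tile.
exists (tile w k); split=> [|c' [/(mem_subsnake _ lr)[k' kb' ->] ke']].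
  by split=> //; apply: mem_tile.
by rewrite (U k').
Qed.

Lemma boundary_tile e k : (l <= k <= r)%N -> tile_edges (tile w k) e ->
  ((k < r)%N -> ~ tile_edges (tile w k.+1) e) ->
  ((l < k)%N -> ~ tile_edges (tile w k.-1) e) -> boundary G e.
Proof.
move=> kb ke nS nP; apply/boundaryE; exists k => // k' kb' ke'.
case: (ltngtP k k') => // kk'.
  by have [E _] := shared_edge kk' ke ke'; subst; case: nS => //; lia.
by have [E _] := shared_edge kk' ke' ke; subst; case: nP => //; lia.
Qed.

(** A shared edge has minimal direction in just one of its tiles, so it is in the matching only if
    [sg] separates the two. *)
Lemma matching_const_boundary sg : (forall k k', sg k = sg k') ->
  matching h G sg `<=` boundary G.
Proof.
move=> cst e /matching_subsnakeE[/mem_edges[k kb ke] H]; apply/boundaryE.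
exists k => // k' kb' ke'; apply: (@minimal_tile_unique h _ _ e) => //.
by rewrite -[LHS]negbK -[RHS]negbK -!H // (cst k k').
Qed.

Lemma boundary_split e : boundary G e -> M e \/ matching h G predT e.
Proof.
move=> /boundaryE[k [kb ke] U].
have eG : edges G e by apply/mem_edges; exists k.
case E: (e.1 == min_horizontal h k); [left|right].
  by apply/matching_subsnakeE; split=> // k' kb' ke'; rewrite (U k') // E.
by apply/matching_subsnakeE; split=> // k' kb' ke'; rewrite (U k') // E.
Qed.

(** Connectedness of the boundary, expressed by functions constant along boundary edges instead of
    by paths. *)
Lemma boundary_connected (T : Type) (A : int * int -> T) :
  (forall e v v', boundary G e -> endpoints e v -> endpoints e v' -> A v = A v') ->
  forall v, vertices G v -> A v = A (tile w l).
Proof.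
move=> inv.
have side b k (p : int * int) : (l <= k <= r)%N -> tile_edges (tile w k) (b, p) ->
  ((k < r)%N -> ~ tile_edges (tile w k.+1) (b, p)) ->
  ((l < k)%N -> ~ tile_edges (tile w k.-1) (b, p)) ->
  A p = A (if b then (p.1 + 1, p.2) else (p.1, p.2 + 1)).
  move=> kb ke nS nP; apply: (inv _ _ _ (boundary_tile kb ke nS nP)); first by left.
  by right.
(* A bottom side is interior only if the previous tile lies below, a left side only if it lies to
   the left. *)
have bottom j : (l <= j <= r)%N -> ((l < j)%N -> glued_right w j.-1) ->
  A (tile w j) = A ((tile w j).1 + 1, (tile w j).2).
  move=> jb gj; rewrite (@side true j) //=; first plane.
    by move=> _; case: ifP => _; plane.
  by case: j gj jb => [|j] gj jb //= /gj /= ->; plane.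
have left j : (l <= j <= r)%N -> ((l < j)%N -> ~~ glued_right w j.-1) ->
  A (tile w j) = A ((tile w j).1, (tile w j).2 + 1).
  move=> jb gj; rewrite (@side false j) //=; first plane.
    by move=> _; case: ifP => _; plane.
  by case: j gj jb => [|j] gj jb //= /gj /= /negbTE ->; plane.
(* The top right corner is reached along the outer side that the next tile does not use. *)
have far j : (l <= j <= r)%N -> let c := tile w j in
  A (c.1 + 1, c.2 + 1) = A (if glued_right w j then (c.1, c.2 + 1) else (c.1 + 1, c.2)).
  move=> jb /=; case E: (glued_right w j); symmetry.
    rewrite (@side true j) //=; first plane.
      by move=> _; rewrite E; plane.
    by case: j E jb => [|j] E jb //=; case: ifP => _ _; plane.
  rewrite (@side false j) //=; first plane.
    by move=> _; rewrite E; plane.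
  by case: j E jb => [|j] E jb //=; case: ifP => _ _; plane.
(* Each tile shares two corners with its predecessor, and the sides above lead to the other two. *)
have corners i : (l + i <= r)%N -> let c := tile w (l + i) in
  [/\ A c = A (tile w l), A (c.1 + 1, c.2) = A (tile w l),
     A (c.1, c.2 + 1) = A (tile w l) & A (c.1 + 1, c.2 + 1) = A (tile w l)].
  elim: i => [|i IH] ir c; rewrite {}/c.
    rewrite addn0 far; last lia.
    rewrite -bottom; [|lia..]; rewrite -left; [|lia..].
    by split=> //; case: ifP => _; rewrite -?bottom -?left //; lia.
  have [|A1 A2 A3 A4] := IH; first lia.
  rewrite addnS in ir *; have ir' : (l <= (l + i).+1 <= r)%N by lia.
  rewrite far //.
  case E: (glued_right w (l + i)).
    have B := bottom (l + i).+1 ir' (fun=> E).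
    by case: (glued_right w (l + i).+1); rewrite -?B /= E /= A2 A4.
  have B := left (l + i).+1 ir' (fun=> negbT E).
  by case: (glued_right w (l + i).+1); rewrite -?B /= E /= A3 A4.
case=> x y [e /mem_edges[k kb ke] ev].
have [|] := corners (k - l)%N; first lia.
have -> : (l + (k - l))%N = k by lia.
by case: (cell_at_vertex ke ev) => -> /=; rewrite ?subrK.
Qed.


Lemma arrow_closed0 : arrow_closed pred0. Proof. by move=> k _; case: ifP. Qed.
Lemma arrow_closedT : arrow_closed predT. Proof. by move=> k _; case: ifP. Qed.

Lemma edges_vertices e v : edges G e -> endpoints e v -> vertices G v.
Proof. by move=> eG ev; exists e. Qed.

Lemma boundary_edges e : boundary G e -> edges G e.
Proof. by case=> c [[cG ce] _]; exists c. Qed.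

Lemma pm_inj P e e' v : perfect_matching G P -> P e -> P e' ->
  endpoints e v -> endpoints e' v -> e = e'.
Proof.
move=> [PG H] Pe Pe' ev ev'; have [f [_ U]] := H v (edges_vertices (PG _ Pe) ev).
by rewrite -(U e) // -(U e').
Qed.

(* Agreement of P with M propagates along boundary edges: each vertex lies on one
   edge of M, one edge of the complementary matching predT, and no other
   boundary edge. *)
Lemma boundary_matching_unique P e0 : perfect_matching G P -> P `<=` boundary G ->
  P e0 -> M e0 -> P = M.
Proof.
move=> pmP Pb Pe0 Me0.
have pmM : perfect_matching G M := matching_perfect h lrn arrow_closed0.
have pmM' : perfect_matching G (matching h G predT) := matching_perfect h lrn arrow_closedT.
pose A v := `[< exists e, [/\ P e, M e & endpoints e v] >].
have step e v v' : boundary G e -> endpoints e v -> endpoints e v' -> A v -> A v'.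
  move=> eb ev ev' /asboolP[f [Pf Mf fv]]; apply/asboolP.
  case: (pselect (P e)) => Pe; first by exists e; split=> //; rewrite (pm_inj pmP Pe Pf ev fv).
  have nMe : ~ M e by move=> Me; apply: Pe; rewrite (pm_inj pmM Me Mf ev fv).
  have M'e : matching h G predT e by case: (boundary_split eb).
  have [g [[Pg gv'] _]] := pmP.2 v' (edges_vertices (boundary_edges eb) ev').
  exists g; split=> //; case: (boundary_split (Pb _ Pg)) => // M'g.
  by case: Pe; rewrite (pm_inj pmM' M'e M'g ev' gv').
have start e : endpoints e e.2 by left.
have all v : vertices G v -> A v.
  have conn : forall v, vertices G v -> A v = A (tile w l).
    by apply: boundary_connected => e u u' eb eu eu'; apply/idP/idP; apply: (step e).
  move=> /conn ->; rewrite -(conn e0.2); first by apply/asboolP; exists e0.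
  exact: edges_vertices (pmP.1 _ Pe0) (start e0).
apply/seteqP; split=> e.
  move=> Pe; have /asboolP[f [Pf Mf fv]] := all _ (edges_vertices (pmP.1 _ Pe) (start e)).
  by rewrite (pm_inj pmP Pe Pf (start e) fv).
move=> Me; have /asboolP[f [Pf Mf fv]] := all _ (edges_vertices (pmM.1 _ Me) (start e)).
by rewrite (pm_inj pmM Me Mf (start e) fv).
Qed.

(** Sinks of the subword on [[l, r]] in the indices of [w]; letters leaving the range do not
    count. *)
Definition local_sink k :=
  ((k < r)%N -> ~~ is_direct w k) /\ ((l < k)%N -> is_direct w k.-1).

Lemma wlen_subword : wlen (subword w l r) = (r - l)%N.
Proof. rewrite /wlen /= size_takel // size_drop leq_sub2r //; by case/andP: lrn. Qed.

Lemma sink_subword k : (l <= k <= r)%N -> sink (subword w l r) (k - l) <-> local_sink k.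
Proof.
move=> kb.
have onth_sub j : onth (letters (subword w l r)) j =
    if (j < r - l)%N then onth (letters w) (l + j) else None.
  rewrite !onthE /= map_take map_drop; case: ltnP => jr; first by rewrite nth_take // nth_drop.
  by rewrite nth_default // size_take size_drop size_map; case: ifP; lia.
have letterE j : (j < r)%N ->
    exists2 a, onth (letters w) j = Some a & direct a = is_direct w j.
  move=> jr; have : (j < size (letters w))%N by apply: leq_trans jr _; case/andP: lrn.
  by rewrite -onthTE /is_direct; case: onth => // a _; exists a.
split=> [sk|[nS nP] j a].
  split=> [kr|lk].
    have [a aE <-] := letterE k kr.
    have := sk (k - l)%N a; rewrite onth_sub.
    have -> : (l + (k - l) = k)%N by lia.
    have -> : (k - l < r - l)%N by lia.
    by move=> /(_ aE)[_]; apply.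
  have [|a aE <-] := letterE k.-1; first lia.
  have := sk (k.-1 - l)%N a; rewrite onth_sub.
  have -> : (l + (k.-1 - l) = k.-1)%N by lia.
  have -> : (k.-1 - l < r - l)%N by lia.
  by move=> /(_ aE)[+ _]; apply; lia.
rewrite onth_sub; case: ltnP => // jr aE.
have [|b bE bd] := letterE (l + j)%N; first lia.
move: bE bd; rewrite aE => -[<-] ->; split=> E.
  by have -> : (l + j)%N = k.-1 by [lia]; apply: nP; lia.
by have -> : (l + j)%N = k by [lia]; apply: nS; lia.
Qed.

(** Follow direct letters from [l] up to the first inverse letter or to [r]: there all arrows of the
    range point inwards. *)
Lemma local_sink_exists : exists2 k, (l <= k <= r)%N & local_sink k.
Proof.
pose p k := (l <= k)%N && ((k == r) || ~~ is_direct w k).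
have exk : exists k, p k by exists r; rewrite /p lr eqxx.
have [k /andP[lk kp] kmin] := ex_minnP exk.
have kr : (k <= r)%N by apply: kmin; rewrite /p lr eqxx.
exists k; first by rewrite lk.
split=> [kr'|lk']; first by case/orP: kp => // /eqP; lia.
by apply: contraT => nd; have : (k <= k.-1)%N; [apply: kmin; rewrite /p nd orbT andbT|]; lia.
Qed.

(** A shared edge has minimal direction only at the source of its arrow, and no arrow starts at a
    sink; so the edge lies in no other tile of the range. *)
Lemma sink_minimal k e : (l <= k <= r)%N -> local_sink k -> tile_edges (tile w k) e ->
  (e.1 == min_horizontal h k) -> M e.
Proof.
move=> kb [nS nP] ke me; apply/matching_subsnakeE; split=> [|k' kb' ke' /=].
  by apply/mem_edges; exists k.
suff <- : k = k' by rewrite me.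
have rn : (r <= wlen w)%N by case/andP: lrn.
case: (ltngtP k k') => // kk'.
  have [E _] := shared_edge kk' ke ke'; subst.
  have := @shared_edge_minimal h k e _ ke ke'; rewrite me => H.
  by have := nS; rewrite -H; [move=> X; exfalso; move: X; lia|lia].
have [E _] := shared_edge kk' ke' ke; subst.
have := @shared_edge_minimal h k' e _ ke' ke; have := nP; rewrite /= => -> //; try lia.
move: me; rewrite /min_horizontal /=.
by case: (e.1) (odd k') (_ && _) => [] [] [] //= _ H; have : false = true by apply: H; lia.
Qed.

Lemma nth_subsnake i : (i <= r - l)%N -> nth (0, 0) G i = tile w (l + i).
Proof. by move=> ib; rewrite (nth_map 0%N) ?size_iota ?nth_iota. Qed.

(** At a sink both sides of minimal direction are in [M], and [M] contains no other side of that
    tile. *)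
Lemma is_pmin_matching0 : is_pmin (subword w l r) G M.
Proof.
split; [exact: matching_perfect arrow_closed0|exact: matching_const_boundary|].
move=> i; rewrite wlen_subword => ib si.
rewrite nth_subsnake //; set k := (l + i)%N; set b := min_horizontal h k; set c := tile w k.
have kb : (l <= k <= r)%N by lia.
have sk : local_sink k by apply/sink_subword => //; have -> : (k - l = i)%N by lia.
exists (b, c), (b, if b then (c.1, c.2 + 1) else (c.1 + 1, c.2)).
have pairE := parallel_edges c b.
split; first by case: (b); plane.
have eqM e : tile_edges c e /\ e.1 = b -> M e.
  by case=> ce eb; apply: (@sink_minimal k) => //; rewrite eb.
apply/seteqP; split=> e /=.
  move=> [[Me _] ce]; suff /pairE : tile_edges c e /\ e.1 = b by [].
  split=> //; have [_ /(_ k kb ce)/=] := (matching_subsnakeE _ _).1 Me.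
  by move/esym/negbFE/eqP.
move=> /pairE ee; have Me := eqM e ee; split; last by case: ee.
by split=> //; apply: matching_const_boundary Me.
Qed.

(** [P] has two boundary edges at some sink. If one of them has minimal direction, it is common to
    [P] and [M], and one common edge forces equality. *)
Lemma pmin_unique P : (l < r)%N -> is_pmin (subword w l r) G P -> P = M.
Proof.
move=> llr [pmP Pb Ps].
have [k kb sk] := local_sink_exists.
have [||e [f [ef PE]]] := Ps (k - l)%N; [by rewrite wlen_subword; lia|exact/sink_subword|].
rewrite nth_subsnake in PE; last lia.
have kE : (l + (k - l))%N = k by lia.
rewrite {}kE in PE.
have [[Pe eb] ke] : (P `&` boundary G `&` tile_edges (tile w k)) e by rewrite PE; left.
have [[Pf fb] kf] : (P `&` boundary G `&` tile_edges (tile w k)) f by rewrite PE; right.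
have [em|em] := boolP (e.1 == min_horizontal h k).
  by apply: (@boundary_matching_unique P e) => //; apply: (sink_minimal kb sk).
have [fm|fm] := boolP (f.1 == min_horizontal h k).
  by apply: (@boundary_matching_unique P f) => //; apply: (sink_minimal kb sk).
(* Otherwise e, f and the interior edge g would be three parallel edges of one
   tile. *)
have [g [kg gm gb]] : exists g,
    [/\ tile_edges (tile w k) g, g.1 != min_horizontal h k & ~ boundary G g].
  have rn : (r <= wlen w)%N by case/andP: lrn.
  have nb j g : (l <= j)%N -> (j < r)%N -> tile_edges (tile w j) g ->
      tile_edges (tile w j.+1) g -> ~ boundary G g.
    move=> lj jr jg jg' /boundaryE[i [ib ig] U].
    by have := U j _ jg; have := U j.+1 _ jg'; lia.
  (* Since [l < r], there is a next tile or else a previous one; at a sink the side shared with it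
     is not of minimal direction. *)
  case: sk => nS nP; case: (ltnP k r) => kr.
    have [g kg kg'] := shared_edge_ex k; exists g; split=> //;
      last by apply: (nb k) => //; lia.
    by rewrite (shared_edge_minimal h _ kg kg') ?nS //; lia.
  case: k kb ke kf em fm PE nS nP kr => [|j] jb ke kf em fm PE nS nP kr; first lia.
  have [g kg kg'] := shared_edge_ex j; exists g; split=> //; last by apply: (nb j) => //; lia.
  apply/negP => gm; have := minimal_tile_unique (h := h) kg kg'.
  by rewrite (shared_edge_minimal h _ kg kg') ?gm ?nP //; lia.
have [E|[E|E]] : g = e \/ g = f \/ e = f.
  by move: ke kf kg em fm gm; case: (e) => [b1 [x1 y1]]; case: (f) => [b2 [x2 y2]];
    case: (g) => [b3 [x3 y3]];
    case: b1 b2 b3 (min_horizontal h k) => [] [] [] []; plane.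
- by rewrite E in gb.
- by rewrite E in gb.
by [].
Qed.

Lemma pmin_subsnake : (l < r)%N -> pmin h (subword w l r) G = M.
Proof.
move=> llr; have -> : pmin h (subword w l r) G =
    xget set0 [set P | is_pmin (subword w l r) G P].
  by rewrite /pmin /G /subsnake; case E: (r - l)%N => [|m] //; lia.
apply: xget_unique; first exact: is_pmin_matching0.
by move=> P; apply: pmin_unique.
Qed.

End Range.

(** * Minimal matching of the whole snake and maximal matchings of subsnakes *)

Lemma subword_full : subword w 0 (wlen w) = w.
Proof. by rewrite /subword drop0 subn0 take_size /wvertex take0 /=; case: w. Qed.

(** With one tile, [min_horizontal h 0] is the convention [h] of [pmin]; otherwise [w] is its own
    subword on the full range. *)
Lemma pmin_snake h : pmin h w (snake w) = matching h (snake w) pred0.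
Proof.
case: (posnP (wlen w)) => n0; last first.
  have := @pmin_subsnake h 0 (wlen w); rewrite subword_full -snakeE; apply=> //.
  by rewrite leqnn.
have pairE e : pmin h w (snake w) e <-> tile_edges (0, 0) e /\ e.1 = h.
  rewrite parallel_edges /pmin /snake n0 /=; case: (h); exact: iff_refl.
have b0 : (0 <= 0 <= wlen w)%N by [].
have mh : min_horizontal h 0 = h by rewrite /min_horizontal n0.
have sE : snake w = subsnake w 0 0 by rewrite snakeE n0.
apply/seteqP; split=> e.
  move=> /pairE[ce eh]; rewrite sE; apply/(matching_subsnakeE h b0).
  split=> [|k]; first by apply/(mem_edges b0); exists 0%N.
  by rewrite leqn0 => /eqP-> _; rewrite mh eh eqxx.
rewrite [X in matching _ X]sE => /(matching_subsnakeE h b0)[/(mem_edges b0)[k]].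
rewrite leqn0 => /eqP-> ce /(_ 0%N (leqnn 0) ce)/esym/negbFE/eqP; rewrite mh => eh.
exact/pairE.
Qed.

(** For [l < r], the boundary minus [M] is the matching of [predT]. A single tile at a sink of [w]
    has both its sides of minimal direction in the minimal matching of the whole snake, so the test
    on [hpair] detects that direction. *)
Lemma pmaxE h l r : (l <= r <= wlen w)%N -> (l = r -> local_sink 0 (wlen w) l) ->
  pmax h w l r = matching h (subsnake w l r) predT.
Proof.
move=> lrn sl; have /andP[lr rn] := lrn; rewrite /pmax; case: eqVneq => [E|ne]; last first.
  rewrite pmin_subsnake //; last by rewrite ltn_neqAle ne.
  apply/seteqP; split=> e; first by case=> /(boundary_split h lrn)[].
  move=> Me; split.
    exact: (matching_const_boundary lrn _ Me).
  move=> /(matching_subsnakeE h lrn)[/(mem_edges lrn)[k kb ke] /(_ k kb ke) E].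
  by move: Me => /(matching_subsnakeE h lrn)[_ /(_ k kb ke)]; rewrite -E.
have b0 : (0 <= wlen w <= wlen w)%N by rewrite leqnn.
have lb : (0 <= l <= wlen w)%N by lia.
have hE c e : hpair c e <-> tile_edges c e /\ e.1 = true by rewrite parallel_edges.
have vE c e : vpair c e <-> tile_edges c e /\ e.1 = false by rewrite parallel_edges.
have singleE e : matching h (subsnake w l r) predT e <->
    tile_edges (tile w l) e /\ e.1 = ~~ min_horizontal h l.
  rewrite matching_subsnakeE //; split=> [[/(mem_edges lrn)[k kb ke] H]|[le eh]].
    have kl : k = l by lia.
    subst k; split=> //; have := H l kb ke; by case: (e.1) (min_horizontal h l) => [] [].
  split=> [|k kb ke]; first by apply/mem_edges => //; exists l => //; lia.
  have -> : k = l by lia.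
  by rewrite eh; case: (min_horizontal h l).
have -> : `[< hpair (tile w l) `<=` pmin h w (snake w) >] = min_horizontal h l.
  rewrite pmin_snake; apply/asboolP/idP => [sub|mh e /hE[le eh]].
    have /sub : hpair (tile w l) (true, tile w l) by left.
    rewrite snakeE => /(matching_subsnakeE h b0)[_ /(_ l lb)].
    rewrite tile_edgesE /= => H.
    by have := H (conj erefl (or_introl erefl)); case: min_horizontal.
  by rewrite snakeE; apply: (sink_minimal b0 lb (sl E) le); rewrite eh mh.
apply/seteqP; split=> e; case: ifP => mh.
- by move=> /vE[le eh]; apply/singleE; rewrite mh eh.
- by move=> /hE[le eh]; apply/singleE; rewrite mh eh.
- by move=> /singleE[le eh]; apply/vE; rewrite eh mh.
- by move=> /singleE[le eh]; apply/hE; rewrite eh mh.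
Qed.

(** * The matching of a submodule and the tiles it encloses *)

Section Submodule.
Variables (h : bool) (S : {set 'I_((wlen w).+1)}).

(** [S] as a predicate on all numbers; the bound is there because [inord] sends indices out of range
    to 0. *)
Definition support k : bool := (k <= wlen w)%N && (inord k \in S).

Lemma support_ord (i : 'I_((wlen w).+1)) : support i = (i \in S).
Proof. by rewrite /support inord_val -ltnS ltn_ord. Qed.

Lemma support_le k : support k -> (k <= wlen w)%N.
Proof. by case/andP. Qed.

Lemma maximal_intervalP (l r : 'I_((wlen w).+1)) : maximal_interval S l r <->
  [/\ (l <= r)%N, forall k, (l <= k <= r)%N -> support k,
      (0 < l)%N -> ~~ support l.-1 & ~~ support r.+1].
Proof.
have ordE k : (k <= wlen w)%N ->
    exists2 i : 'I_((wlen w).+1), i = k :> nat & support k = (i \in S).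
  by move=> kn; exists (inord k); rewrite ?inordK // /support kn.
have rn := ltn_ord r.
split=> -[lr mid lo hi]; split=> //.
- move=> k kb; have [|i ik ->] := ordE k; first lia.
  by apply: mid; rewrite ik.
- move=> l0; have [|i ik ->] := ordE l.-1; first lia.
  by apply: lo; lia.
- case: (leqP r.+1 (wlen w)) => rn'; last by rewrite /support leqNgt rn'.
  by have [i ik ->] := ordE _ rn'; apply: hi.
- by move=> k kb; rewrite -support_ord mid.
- by move=> k kl; rewrite -support_ord; have -> : k = l.-1 :> nat by [lia]; apply: lo; lia.
- by move=> k kr; rewrite -support_ord kr.
Qed.

(** Extend [k] to the left and to the right as far as the support allows. *)
Lemma maximal_interval_ex k : support k -> exists l r : 'I_((wlen w).+1),
  maximal_interval S l r /\ (l <= k <= r)%N.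
Proof.
move=> sk.
have exl : exists l, (l <= k)%N && all support (iota l (k - l).+1).
  by exists k; rewrite leqnn subnn /= sk.
have [l /andP[lk /allP la] lmin] := ex_minnP exl.
have exr : exists r, (k <= r)%N && all support (iota k (r - k).+1).
  by exists k; rewrite leqnn subnn /= sk.
have [|r /andP[kr /allP ra] rmax] := @ex_maxnP _ (wlen w) exr.
  move=> r /andP[kr /allP ra]; apply: support_le; apply: ra; rewrite mem_iota; lia.
have ls m : (l <= m <= k)%N -> support m by move=> mb; apply: la; rewrite mem_iota; lia.
have rs m : (k <= m <= r)%N -> support m by move=> mb; apply: ra; rewrite mem_iota; lia.
have rn : (r < (wlen w).+1)%N by rewrite ltnS; apply: support_le; apply: rs; lia.
have ln : (l < (wlen w).+1)%N by lia.
exists (Ordinal ln), (Ordinal rn); split; last by rewrite /= lk.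
apply/maximal_intervalP => /=; split; first lia.
- by move=> m mb; case: (leqP m k) => mk; [apply: ls|apply: rs]; lia.
- move=> l0; apply/negP => sl; have := lmin l.-1.
  suff -> : (l.-1 <= k)%N && all support (iota l.-1 (k - l.-1).+1) by lia.
  apply/andP; split; first lia.
  apply/allP => m; rewrite mem_iota => mb.
  by case: (eqVneq m l.-1) => [->//|ml]; apply: ls; lia.
apply/negP => sr; have := rmax r.+1.
suff -> : (k <= r.+1)%N && all support (iota k (r.+1 - k).+1) by lia.
apply/andP; split; first lia.
apply/allP => m; rewrite mem_iota => mb.
by case: (eqVneq m r.+1) => [->//|ml]; apply: rs; lia.
Qed.

Hypothesis closed : arrow_closed support.

(** An arrow starting at [l] would carry the support to a neighbour, against maximality. *)
Lemma interval_sink (l r : 'I_((wlen w).+1)) : maximal_interval S l r -> l = r :> nat -> 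
  local_sink 0 (wlen w) l.
Proof.
move=> /maximal_intervalP[_ mid lo hi] lr; have sl : support l by apply: mid; lia.
split=> kl.
  by have := closed kl; case: ifP => // _ /(_ sl); rewrite lr (negbTE hi).
have := @closed l.-1; rewrite prednK //; case: is_direct => // H.
by have := lo kl; rewrite H //; have := ltn_ord l; lia.
Qed.

(** An edge on a tile of the support is governed by the interval of that tile; any other edge lies
    on no interval and follows the minimal matching. *)
Lemma pphiE : pphi h S = matching h (snake w) support.
Proof.
have b0 : (0 <= wlen w <= wlen w)%N by rewrite leqnn.
have pmaxI (l r : 'I_((wlen w).+1)) : maximal_interval S l r ->
    (l <= r <= wlen w)%N /\ pmax h w l r = matching h (subsnake w l r) predT.
  move=> lrI; have /maximal_intervalP[lr _ _ _] := lrI; have := ltn_ord r => rn.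
  have lrn : (l <= r <= wlen w)%N by lia.
  by split=> //; apply: pmaxE => //; apply: interval_sink.
rewrite /pphi pmin_snake snakeE; apply/seteqP; split=> e.
  case=> [[l [r [lrI]]]|[/(matching_subsnakeE h b0)[eG H] nI]].
    have [lrn ->] := pmaxI _ _ lrI.
    have /maximal_intervalP[_ mid lo hi] := lrI.
    move=> /(matching_subsnakeE h lrn)[/(mem_edges lrn)[k kb ke] H].
    apply/(matching_subsnakeE h b0); split=> [|k' kb' ke'].
      by apply/(mem_edges b0); exists k => //; lia.
    case: (boolP (l <= k' <= r)%N) => [lr'|out]; first by rewrite mid // -H.
    have kk' : k <> k' by move=> E; rewrite -E kb in out.
    (* Another tile containing [e] outside the interval is [r.+1] or [l.-1], off the support by
       maximality, and [e] has minimal direction there. *)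
    rewrite (@minimal_opposite h k) // -H //=; apply/negbTE.
    case: (ltngtP k k') => // lt.
      by have [E _] := shared_edge lt ke ke'; have -> : k' = r.+1 by lia.
    have [E _] := shared_edge lt ke' ke; have -> : k' = l.-1 by lia.
    by apply: lo; lia.
  apply/(matching_subsnakeE h b0); split=> // k kb ke; rewrite -H //.
  apply/negP => /maximal_interval_ex[l [r [lrI klr]]]; apply: nI; exists l, r; split=> //.
  by have [lrn _] := pmaxI _ _ lrI; apply/mem_edges => //; exists k.
move=> /(matching_subsnakeE h b0)[/(mem_edges b0)[k kb ke] H].
case: (pselect (exists2 j, support j & tile_edges (tile w j) e)) => [[j sj je]|no].
  left; have [l [r [lrI jlr]]] := maximal_interval_ex sj; exists l, r; split=> //.
  have [lrn ->] := pmaxI _ _ lrI.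
  apply/matching_subsnakeE => //; split=> [|i ib ie]; first by apply/mem_edges => //; exists j.
  have /maximal_intervalP[_ mid _ _] := lrI.
  by rewrite -H ?mid //; lia.
right; split.
  apply/(matching_subsnakeE h b0); split=> [|i ib ie]; first by apply/(mem_edges b0); exists k.
  by rewrite -H //=; symmetry; apply/negP => si; apply: no; exists i.
move=> [l [r [lrI]]]; have [lrn _] := pmaxI _ _ lrI; have /maximal_intervalP[_ mid _ _] := lrI.
by move=> /(mem_edges lrn)[i ib ie]; apply: no; exists i => //; apply: mid.
Qed.

(** Both matchings treat edges off the support alike, and an edge between two tiles of the support
    is in neither, having minimal direction in only one of them. *)
Lemma symdiff_pphi :
  symdiff (pphi h S) (pmin h w (snake w)) = boundary [seq c <- snake w | support (level c)].
Proof.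
have b0 : (0 <= wlen w <= wlen w)%N by rewrite leqnn.
have in_sub c : c \in [seq c <- snake w | support (level c)] <->
    exists2 k, support k & c = tile w k.
  rewrite mem_filter snakeE.
  split=> [/andP[sc /(mem_subsnake _ (leq0n _))[k kb cE]]|[k sk ->]].
    by exists k => //; rewrite -(level_tile k) -cE.
  by rewrite level_tile sk; apply: (mem_tile b0); rewrite (support_le sk).
rewrite pphiE pmin_snake snakeE.
have tilesE e : boundary [seq c <- subsnake w 0 (wlen w) | support (level c)] e <->
    exists2 k, support k /\ tile_edges (tile w k) e &
      forall k', support k' -> tile_edges (tile w k') e -> k' = k.
  rewrite -snakeE; split=> [[c [[/in_sub[k sk ->] ke] U]]|[k [sk ke] U]].
    exists k => // k' sk' ke'; apply: tile_inj; symmetry; apply: U; split=> //.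
    by apply/in_sub; exists k'.
  exists (tile w k); split=> [|c' [/in_sub[k' sk' ->] ke']].
    by split=> //; apply/in_sub; exists k.
  by rewrite (U k').
apply/seteqP; split=> e.
  case=> AB nAB; apply/tilesE.
  have [k [kb ke sk U]] : exists k, [/\ (k <= wlen w)%N, tile_edges (tile w k) e, support k &
     forall k', (k' <= wlen w)%N -> tile_edges (tile w k') e -> support k' -> k' = k].
    (* If [e] is in the matching of [S], it is non-minimal in all its tiles of the support; if it is
       in the minimal matching, it is minimal in all its tiles. Either way there is only one such
       tile. *)
    case: AB => Ae; have [/(mem_edges b0)[k kb ke] H] := (matching_subsnakeE h b0 _ _).1 Ae.
      have : exists j, [/\ (j <= wlen w)%N, tile_edges (tile w j) e & support j].
        apply: contrapT => no; apply: nAB; split=> //; apply/(matching_subsnakeE h b0).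
        split=> [|j jb je]; first by apply/(mem_edges b0); exists k.
        by rewrite -H //=; symmetry; apply/negP => sj; apply: no; exists j.
      move=> [j [jb je sj]]; exists j; split=> // k' kb' ke' sk'.
      apply: (minimal_tile_unique (h := h) ke' je).
      by rewrite -[LHS]negbK -[RHS]negbK -!H // sj sk'.
    exists k; split=> // [|k' kb' ke' _]; last first.
      apply: (minimal_tile_unique (h := h) ke' ke).
      by rewrite -[LHS]negbK -[RHS]negbK -!H.
    apply: contrapT => /negP/negbTE sk; apply: nAB; split=> //.
    apply/(matching_subsnakeE h b0).
    split=> [|j jb je]; first by apply/(mem_edges b0); exists k.
    have -> : j = k.
      apply: (minimal_tile_unique (h := h) je ke).
      by rewrite -[LHS]negbK -[RHS]negbK -!H.
    by rewrite sk -H.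
  by exists k => // k' sk' ke'; apply: U => //; apply: support_le.
move=> /tilesE[k [sk ke] U].
have kn := support_le sk.
have eG : edges (subsnake w 0 (wlen w)) e by apply/(mem_edges b0); exists k.
have others k' : tile_edges (tile w k') e -> k' <> k -> support k' = false.
  by move=> ke' kk'; apply/negP => sk'; apply: kk'; apply: U.
case: (boolP (e.1 == min_horizontal h k)) => mk.
  (* Here tile [k] is the source of any arrow across [e], so by closure a second tile would lie in
     the support. *)
  have alone k' : (k' <= wlen w)%N -> tile_edges (tile w k') e -> k' = k.
    move=> kb' ke'; apply: contrapT => kk'; have sk' := others _ ke' kk'.
    case: (ltngtP k k') => // lt; last by rewrite lt in kk'.
      have [E _] := shared_edge lt ke ke'; subst k'.
      have := closed kb'; have := shared_edge_minimal h kb' ke ke'.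
      by rewrite mk => <- /(_ sk); rewrite sk'.
    have [E _] := shared_edge lt ke' ke; subst k.
    have := closed kn; have := shared_edge_minimal h kn ke' ke.
    have := minimal_opposite h ke' ke kk'; rewrite mk /= => /esym/negbFE/negbTE-> <- /(_ sk).
    by rewrite sk'.
  split; [right|case] => [|/(matching_subsnakeE h b0)[_ /(_ k kn ke)]].
    apply/(matching_subsnakeE h b0); split=> // k' kb' ke' /=.
    by rewrite (alone k') // mk.
  by rewrite sk mk.
(* Now [e] has minimal direction in any other tile, which is off the support, so [e] is in the
   matching of [S] only. *)
split; [left|case=> _ /(matching_subsnakeE h b0)[_ /(_ k kn ke)]]; last by rewrite mk.
apply/(matching_subsnakeE h b0); split=> // k' kb' ke'.
case: (pselect (k' = k)) => [->|kk']; first by rewrite sk.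
by rewrite (others k') // (@minimal_opposite h k k') ?mk //; apply: nesym.
Qed.

Lemma enclosed_pphi k : (k <= wlen w)%N ->
  enclosed (symdiff (pphi h S) (pmin h w (snake w))) (tile w k) <-> support k.
Proof.
move=> kn; rewrite symdiff_pphi; split=> [|sk]; last first.
  apply: enclosed_mem; rewrite mem_filter level_tile sk snakeE.
  by apply: (@mem_tile 0 (wlen w)); rewrite ?leqnn.
move=> enc; apply: contrapT => /negP/negbTE nsk.
(* The ray goes up if the next tile is to the right, and right if it is on top. *)
apply: (@not_enclosed_ray _ _ (~~ glued_right w k) _ enc) => m; rewrite mem_filter.
case: m => [|m].
  suff -> : (if ~~ glued_right w k then ((tile w k).1 + 0%N%:Z, (tile w k).2)
             else ((tile w k).1, (tile w k).2 + 0%N%:Z)) = tile w k by rewrite level_tile nsk.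
  by case: ifP; plane.
apply/negP => /andP[_]; rewrite snakeE => /(mem_subsnake _ (leq0n _))[j _].
by have := @tile_off_ray k j m; case: (glued_right w k).
Qed.

End Submodule.

End Snake.

(** * From submodules to arrow-closed index sets *)

Section Module.
Local Open Scope ring_scope.
Variables (K : fieldType) (Q : quiver) (w : word Q).
Import GRing.Theory.
Implicit Types (S : {set 'I_((wlen w).+1)}).

(** The column [delta_mx j 0] reads off coordinate [j] and kills every basis vector indexed by
    [S]. *)
Lemma basis_span_coord S (v : 'rV[K]_((wlen w).+1)) j :
  (v <= basis_span K S)%MS -> j \notin S -> v 0 j = 0.
Proof.
move=> vS jS.
have : (v <= kermx (delta_mx j 0 : 'cV[K]_((wlen w).+1)))%MS.
  apply: submx_trans vS _; apply/sumsmx_subP => i iS; rewrite genmxE.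
  apply/sub_kermxP; rewrite mul_delta_mx_0 //; by apply: contraNneq jS => <-.
move=> /sub_kermxP/matrixP/(_ 0 0); rewrite !mxE (bigD1 j) //= big1 ?addr0.
  by rewrite mxE !eqxx mulr1.
by move=> m mj; rewrite mxE (negbTE mj) mulr0.
Qed.

Lemma wvertexS k a : onth (letters w) k = Some a -> wvertex w k.+1 = ltgt a.
Proof.
move=> ka; have kn : (k < size (letters w))%N by rewrite -onthTE ka.
by rewrite /wvertex (take_nth a kn) map_rcons last_rcons (onth_nth _ _ _ _ ka).
Qed.

Lemma act_arrow (b : Q1 Q) :
  exists x : pathalg K Q, act w x = vertex_mx K w (src b) *m arrow_mx K w b.
Proof.
have cb : composable (src b, [:: b]).1 (src b, [:: b]).2 by rewrite /= eqxx.
exists << QPath cb >>.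
by rewrite /act msuppU oner_eq0 big_seq_fset1 mcoeffUU scale1r.
Qed.

(** The vertex idempotent fixes the [i]-th basis vector, so its image under [b] has the entry [i j]
    of the arrow matrix as coordinate [j]; off [S] this must vanish. *)
Lemma submodule_arrow S (i j : 'I_((wlen w).+1)) b : submodule (basis_span K S) ->
  wvertex w i = src b -> arrow_mx K w b i j != 0 -> i \in S -> j \in S.
Proof.
move=> hN vi bij iS; apply: contraNT bij => jS.
have [x xE] := act_arrow b.
have : ((delta_mx 0 i : 'rV[K]_((wlen w).+1)) *m act w x <= basis_span K S)%MS.
  have U : (basis_span K S *m act w x <= basis_span K S)%MS := hN x.
  apply: submx_trans U; apply: submxMr.
  by apply: (sumsmx_sup i) => //; rewrite genmxE.
move=> /basis_span_coord/(_ jS); rewrite -rowE mxE xE mxE (bigD1 i) //= big1 => [|m mi].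
  by rewrite addr0 [vertex_mx _ _ _ _ _]mxE eqxx vi eqxx mul1r => /eqP.
by rewrite mxE eq_sym (negbTE mi) mul0r.
Qed.

Lemma submodule_closed S :
  is_walk w -> submodule (basis_span K S) -> arrow_closed w (support S).
Proof.
move=> walk hN k kn; rewrite /is_direct.
case E: (onth (letters w) k) => [[b d]|]; last first.
  by have := onthTE (letters w) k; rewrite E -/(wlen w) kn.
have k1 : (k < (wlen w).+1)%N by lia.
have k2 : (k.+1 < (wlen w).+1)%N by lia.
rewrite -[k]/(nat_of_ord (Ordinal k1)) -[(Ordinal k1 : nat).+1]/(nat_of_ord (Ordinal k2)).
rewrite !support_ord.
have := walk _ _ E; have := wvertexS E; rewrite /lsrc /ltgt /=.
(* A direct letter is an arrow out of index [k], an inverse one an arrow out of [k.+1]; the matrix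
   entry is 1 in both cases. *)
case: d E => E v2 v1; apply: (@submodule_arrow S _ _ b hN) => //.
  by rewrite mxE /= E !eqxx oner_eq0.
by rewrite mxE /= E !eqxx orbT oner_eq0.
Qed.

End Module.

Theorem proposition3p4 (K : fieldType) (Q : quiver) (I : set (pathalg K Q))
    (hI : admissible I)
    (w : word Q) (hw : is_string I w) (hM : quotient_module I w)
    (S : {set 'I_((wlen w).+1)}) (hN : submodule (basis_span K S))
    (h : bool) :
  perfect_matching (snake w) (pphi h S) /\
  (basis_span K S == matching_module K h w (pphi h S))%MS.
Proof.
have [walk _ _ _] := hw.
have closed := submodule_closed walk hN.
split.
  by rewrite pphiE // snakeE; apply: matching_perfect; rewrite ?leqnn.
rewrite /matching_module.
(* Both modules are spans of basis vectors, so it is enough to compare the index sets. *)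
suff -> : [set i : 'I_((wlen w).+1) |
      `[< enclosed (symdiff (pphi h S) (pmin h w (snake w))) (tile w i) >]]%SET = S.
  by rewrite submx_refl.
apply/setP => i; rewrite finset.inE -support_ord; apply/asboolP/idP.
  by move/enclosed_pphi; apply=> //; rewrite -ltnS.
by move=> si; apply/enclosed_pphi => //; rewrite -ltnS.
Qed.
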